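(* Let $g\geq 3$ and $t\geq 1$ be integers, and let $k$ be a positive integer such that $k\geq (t+1)(g-1)$ if $g$ is even and $k\geq (t+2)(g+1)$ if $g$ is odd. Then there exists a digraph with girth $g$ and minimum outdegree at least $\lceil \frac{g}{g-1}k\rceil$ which contains at most $k-t$ pairwise vertex-disjoint directed cycles.
   Context: Digraphs are finite and simple (no loops, no parallel arcs; directed $2$-cycles allowed). A cycle means a directed cycle. The girth of a digraph is the length of its shortest directed cycle. *)

(* Defs.v *)
From mathcomp Require Import all_boot all_order all_algebra.

Set Implicit Arguments.
Unset Strict Implicit.
Unset Printing Implicit Defensive.

(* Arcs form a relation, so parallel arcs cannot occur; opposite arcs
   (directed 2-cycles) are allowed. *)
Record digraph := Digraph {
  vertex :> finType;
  arc : rel vertex;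
  arc_irrefl : irreflexive arc }.

Definition outdeg (G : digraph) (v : G) : nat := #|[set w | arc v w]|.

(* The neutral element #|G| bounds every outdegree, so for nonempty G this is
   the true minimum. *)
Definition min_outdeg (G : digraph) : nat := \big[minn/#|G|]_(v : G) outdeg v.

(* A directed cycle is the list of its vertices in cyclic order; its length is
   the size of the list. The library's ucycle also holds of the empty list,
   which is excluded here. *)
Definition dicycle (G : digraph) (c : seq G) : Prop :=
  c <> [::] /\ ucycle (@arc G) c.

Definition has_girth (G : digraph) (g : nat) : Prop :=
  (exists2 c : seq G, dicycle c & size c = g) /\
  (forall c : seq G, dicycle c -> g <= size c).

(* Since cycles are nonempty, disjointness forces the members of the list to be
   distinct, so size cs is the number of cycles in the family. *)
Definition disjoint_dicycles (G : digraph) (cs : seq (seq G)) : Prop :=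
  (forall c : seq G, c \in cs -> dicycle c) /\
  pairwise (fun c d : seq G => [disjoint c & d]) cs.

(* Main.v *)
(* Take d = 2 (k - t) and d + 1 hubs. Each hub v owns m = (g - 1) / 2 levels of
   d vertices; all arcs run from v to its first level, from each level to the
   next one, and from the last level to the d other hubs. The levels of v lead
   only to other hubs, so every cycle meets at least two hubs: there are at most
   (d + 1) / 2, hence k - t, disjoint cycles, and the shortest cycles have length
   2 (m + 1). For odd g one hub skips its first level, which makes the girth
   2 m + 1. *)
Require Import Defs.
From mathcomp Require Import all_boot all_order all_algebra.
From mathcomp Require Import zify.

Set Implicit Arguments.
Unset Strict Implicit.
Unset Printing Implicit Defensive.

Lemma min_outdeg_geq (G : digraph) d :
  d <= #|G| -> (forall v : G, d <= outdeg v) -> d <= min_outdeg G.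
Proof.
move=> dG dout; rewrite /min_outdeg.
by elim/big_ind: _ => // x y dx dy; rewrite leq_min dx.
Qed.

Lemma uniq_flatten_disjoint (T : finType) (cs : seq (seq T)) :
  (forall c, c \in cs -> uniq c) ->
  pairwise (fun c d : seq T => [disjoint c & d]) cs -> uniq (flatten cs).
Proof.
elim: cs => //= c cs IHcs Ucs /andP[/allP dis_c dis_cs].
rewrite cat_uniq Ucs ?mem_head // IHcs ?andbT // => [|e e_cs]; last first.
  by rewrite Ucs // inE e_cs orbT.
apply/hasPn => x /flattenP[e e_cs xe].
by rewrite (disjointFl (dis_c e e_cs) xe).
Qed.

(** The concatenation repeats no element, so it has at most [#|A|] entries in [A], and each sequence
    supplies at least [r] of them. *)
Lemma size_disjoint_seqs (T : finType) (A : {pred T}) (cs : seq (seq T)) r :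
  uniq (flatten cs) -> (forall c, c \in cs -> r <= count A c) ->
  r * size cs <= #|A|.
Proof.
move=> Ucs rcs; have le_r: r * size cs <= count A (flatten cs).
  elim: cs rcs {Ucs} => [|c cs IHcs] rcs /=; first by rewrite muln0.
  rewrite mulnS count_cat leq_add ?rcs ?mem_head //.
  by apply: IHcs => e e_cs; rewrite rcs // inE e_cs orbT.
apply: leq_trans le_r _; rewrite -size_filter -(card_uniqP _); last first.
  exact: filter_uniq.
by apply/subset_leq_card/subsetP => x; rewrite mem_filter => /andP[].
Qed.

(** * The hub graph and its outdegrees *)

Section HubGraph.

(* There are [d.+2] hubs, each with [m.+1] levels of [d.+1] vertices, so that all
   index types are inhabited; [skip] makes the hub [ord0] skip its first level. *)
Variables (d m : nat) (skip : bool).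

Definition hub_vertex : finType := ('I_d.+2 + 'I_d.+2 * ('I_m.+1 * 'I_d.+1))%type.

Definition entry (v : 'I_d.+2) : nat := skip && (v == ord0).

Definition is_hub (x : hub_vertex) : bool := if x is inl _ then true else false.

Definition owner (x : hub_vertex) : 'I_d.+2 :=
  match x with inl v => v | inr y => y.1 end.

(* Levels are numbered from 1; a hub sits one level below those it points to. *)
Definition level (x : hub_vertex) : nat :=
  match x with inl v => entry v | inr y => y.2.1.+1 end.

Definition hub_arc : rel hub_vertex := fun x y =>
  if is_hub y then (level x == m.+1) && (owner y != owner x)
  else (owner y == owner x) && (level y == (level x).+1).

Lemma hub_arc_irrefl : irreflexive hub_arc.
Proof.
by move=> x; rewrite /hub_arc eqxx andbF; case: ifP => // _; apply/negbTE; lia.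
Qed.

Definition hub_graph : digraph := Digraph hub_arc_irrefl.

Lemma entry_leq1 v : entry v <= 1.
Proof. by rewrite /entry; case: (_ && _). Qed.

(** Only [ord0] can skip a level, so two distinct hubs together lose at most one. *)
Lemma entryD u v : u != v -> entry u + entry v <= skip.
Proof.
rewrite /entry; case: skip => //=; case: (eqVneq u ord0) => [-> | _ _].
  by rewrite eq_sym => /negbTE->.
exact: leq_b1.
Qed.

Lemma level_leq x : level x <= m.+1.
Proof.
case: x => [v|[v [i j]]] /=; last exact: ltn_ord.
exact: leq_trans (entry_leq1 v) _.
Qed.

Lemma outdeg_hub_graph (x : hub_graph) : d.+1 <= outdeg x.
Proof.
rewrite /outdeg; have := level_leq x.
rewrite leq_eqVlt => /orP[/eqP lx|lx].
  have D: #|[set inl u | u in [set~ owner x]] : {set hub_vertex}| = d.+1.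
    by rewrite (card_imset _ (@inl_inj _ _)) cardsC1 card_ord.
  rewrite -[leqLHS]D.
  apply/subset_leq_card/subsetP => y /imsetP[u]; rewrite !inE => ux ->{y}.
  by rewrite /= /hub_arc /= lx eqxx.
have D: #|[set inr (owner x, (Ordinal lx, j)) | j : 'I_d.+1]
          : {set hub_vertex}| = d.+1.
  by rewrite card_imset ?card_ord // => i j [].
rewrite -[leqLHS]D; apply/subset_leq_card/subsetP => y /imsetP[j _ ->{y}].
by rewrite inE /= /hub_arc /= !eqxx.
Qed.

Lemma leq_min_outdeg_hub_graph : d.+1 <= min_outdeg hub_graph.
Proof.
apply: min_outdeg_geq outdeg_hub_graph.
rewrite card_sum card_ord; lia.
Qed.

(** * Hubs on a cycle and lower bounds on its length *)

Lemma card_is_hub : #|is_hub| = d.+2.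
Proof.
have D: #|[set inl u | u : 'I_d.+2] : {set hub_vertex}| = d.+2.
  by rewrite (card_imset _ (@inl_inj _ _)) card_ord.
rewrite -[RHS]D; apply: eq_card => -[v|y]; apply/esym; first exact: imset_f.
by apply/imsetP => -[].
Qed.

(** For a hub, this counts the vertices on a climb from it to its top level, the hub included. *)
Definition stretch (x : hub_vertex) : nat := is_hub x * (m.+2 - level x).

(* The level is a potential: it drops by [m.+1 - level y] on an arc entering a
   hub [y] and rises by 1 on every other arc. *)
Lemma hub_path_level (x : hub_vertex) p : path hub_arc x p ->
  level (last x p) + \sum_(y <- p) stretch y = level x + size p.
Proof.
elim: p x => [|y p IHp] x /=; first by rewrite big_nil.
case/andP=> xy /IHp; rewrite big_cons /stretch.
have := level_leq y; move: xy; rewrite /hub_arc.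
by case: (is_hub y) => /andP[/eqP ? /eqP ?] /=; lia.
Qed.

(** Around a cycle the potential returns to its starting value, so the two levels cancel. *)
Lemma hub_cycle_size (c : seq hub_graph) :
  cycle hub_arc c -> size c = \sum_(y <- c) stretch y.
Proof.
case: c => [|x p] /=; first by rewrite big_nil.
move/hub_path_level; rewrite last_rcons => /addnI.
by rewrite size_rcons => <-; rewrite big_rcons big_cons addnC.
Qed.

Lemma hub_path_owner (x : hub_vertex) p : path hub_arc x p ->
  ~~ has is_hub p -> owner (last x p) = owner x.
Proof.
elim: p x => //= y p IHp x /andP[xy py]; rewrite negb_or => /andP[Ny Np].
rewrite (IHp y) //; move: xy; rewrite /hub_arc (negbTE Ny).
by case/andP=> /eqP.
Qed.

(** Without hubs the total stretch, hence the length, would be 0. With a single hub the owner would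
    stay constant up to the last arc, but an arc into a hub changes the owner. *)
Lemma hub_cycle_has2 (c : seq hub_graph) : c != [::] -> cycle hub_arc c ->
  exists v p1 u p2, perm_eq c (inl v :: p1 ++ inl u :: p2).
Proof.
move=> c_n0 Cc; have /hasP[x xc hub_x]: has is_hub c.
  apply: contraT => /hasPn Nc; case/eqP: c_n0; apply: size0nil.
  rewrite hub_cycle_size // big_seq big1 // => y /Nc Ny.
  by rewrite /stretch (negbTE Ny).
case: x hub_x xc => // v _ /rot_to[i p Dp].
have: cycle hub_arc (inl v :: p) by rewrite -Dp rot_cycle.
rewrite /= rcons_path => /andP[Pp]; rewrite /hub_arc /= => /andP[_ Np].
have /hasP[y yp hub_y]: has is_hub p.
  by apply: contraR Np => Np; rewrite (hub_path_owner Pp Np).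
case: y hub_y yp => // u _ /splitPr Dsp; case: Dsp Dp => p1 p2 Dp.
by exists v, p1, u, p2; rewrite -Dp perm_sym perm_rot.
Qed.

Lemma hub_dicycle_count (c : seq hub_graph) : dicycle c -> 2 <= count is_hub c.
Proof.
case=> /eqP c_n0 /andP[Cc _].
have [v [p1 [u [p2 /permP->]]]] := hub_cycle_has2 c_n0 Cc.
by rewrite /= count_cat /=; lia.
Qed.

Lemma hub_dicycle_size (c : seq hub_graph) : dicycle c -> m.+2.*2 - skip <= size c.
Proof.
case=> /eqP c_n0 /andP[Cc Uc]; rewrite hub_cycle_size //.
have [v [p1 [u [p2 Dc]]]] := hub_cycle_has2 c_n0 Cc.
move: Uc; rewrite (perm_uniq Dc) (perm_big _ Dc) /=.
rewrite big_cons big_cat big_cons /= mem_cat inE !negb_or => /andP[/and3P[_ vu _] _].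
have {vu}: v != u by apply: contraNneq vu => ->.
move/entryD; rewrite /stretch /= => leD.
have := entry_leq1 v; have := entry_leq1 u; lia.
Qed.

(** * A shortest cycle *)

Definition level_vertex (v : 'I_d.+2) (i : nat) : hub_vertex :=
  inr (v, (inord i, ord0)).

Definition hub_branch (v : 'I_d.+2) : seq hub_vertex :=
  [seq level_vertex v i | i <- iota (entry v) (m.+1 - entry v)].

Lemma all_owner_branch v : all (fun x => owner x == v) (inl v :: hub_branch v).
Proof. by rewrite /= eqxx all_map; apply/allP => i _ /=. Qed.

(** Consecutive levels yield the arcs of the branch, its end at the top level, its lack of
    repetitions and its length. *)
Lemma map_level_branch v :
  map level (inl v :: hub_branch v) = iota (entry v) (m.+2 - entry v).
Proof.
rewrite subSn; last exact: leq_trans (entry_leq1 v) _.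
rewrite /= -map_comp (iotaDl 1); congr (_ :: _); apply/eq_in_map => i.
by rewrite mem_iota /= => lti; rewrite inordK //; have := entry_leq1 v; lia.
Qed.

Lemma hub_branch_path v : path hub_arc (inl v) (hub_branch v).
Proof.
have := map_level_branch v; have := all_owner_branch v.
have: ~~ has is_hub (hub_branch v) by rewrite has_map; apply/hasPn.
rewrite subSn; last exact: leq_trans (entry_leq1 v) _.
(* The start need not be a hub: consecutive levels, a common owner and a hub-free tail suffice, and
   they pass to the tail. *)
move: (_ - _) => n; move: (inl v : hub_vertex) (hub_branch v) (entry v) => x p.
elim: p x n => //= y p IHp x [|n] a; first by move=> _ _ [].
rewrite negb_or => /andP[Ny Np] /and3P[ox oy op] [lx ly lp].
rewrite (IHp y n a.+1) ?Np ?oy ?op ?andbT //=; last by rewrite ly lp.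
by rewrite /hub_arc (negbTE Ny) (eqP ox) (eqP oy) eqxx lx ly eqxx.
Qed.

Lemma hub_branch_arc v u : u != v -> hub_arc (last (inl v) (hub_branch v)) (inl u).
Proof.
move=> neq_uv; rewrite /hub_arc /=; apply/andP; split.
  rewrite -(last_map level) -[last _ _]/(last 0 (map level (inl v :: hub_branch v))).
  rewrite map_level_branch -nth_last size_iota nth_iota; have := entry_leq1 v; lia.
have /allP/(_ (last (inl v) (hub_branch v)) (mem_last _ _))/eqP-> //
  := all_owner_branch v.
Qed.

Lemma hub_girth : has_girth hub_graph (m.+2.*2 - skip).
Proof.
split=> [|c]; last exact: hub_dicycle_size.
pose c v := inl v :: hub_branch v : seq hub_vertex.
have n10: (inord 1 : 'I_d.+2) != ord0 by rewrite -val_eqE /= inordK.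
(* Two climbs are joined; one starts at [ord0], so that a skipped level shortens the cycle. *)
exists (c ord0 ++ c (inord 1)); last first.
  rewrite size_cat -!(size_map level) !map_level_branch !size_iota /entry eqxx.
  by rewrite (negbTE n10) andbT andbF; case: skip; lia.
split=> //; apply/andP; split.
  rewrite /= rcons_path cat_path /= last_cat !hub_branch_path /=.
  by rewrite !hub_branch_arc // eq_sym.
have Uc v : uniq (c v).
  by apply: (@map_uniq _ _ level); rewrite map_level_branch iota_uniq.
rewrite cat_uniq !Uc andbT andTb; apply/hasPn => x.
move/(allP (all_owner_branch _)) => /eqP ox; apply: contra n10 => xc.
by have := allP (all_owner_branch _) _ xc; rewrite /= ox.
Qed.

Lemma hub_disjoint_dicycles (cs : seq (seq hub_graph)) :
  disjoint_dicycles cs -> 2 * size cs <= d.+2.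
Proof.
case=> Ccs Dcs; rewrite -card_is_hub; apply: size_disjoint_seqs => [|c /Ccs].
  by apply: uniq_flatten_disjoint Dcs => c /Ccs[_ /andP[]].
exact: hub_dicycle_count.
Qed.

End HubGraph.

Theorem theorem2 (g t k : nat) (hg : 3 <= g) (ht : 1 <= t) (hk : 0 < k)
    (hk_even : ~~ odd g -> (t + 1) * (g - 1) <= k)
    (hk_odd : odd g -> (t + 2) * (g + 1) <= k) :
  exists G : digraph,
    [/\ has_girth G g,
        (Num.ceil (g%:R / (g%:R - 1) * k%:R : rat) <= (min_outdeg G)%:Z)%R
      & forall cs : seq (seq G), disjoint_dicycles cs -> size cs <= k - t].
Proof.
(* The second inequality is the outdegree bound for [2 * (k - t)], cleared of [g - 1]; it amounts to
   [2 * t * (g - 1) <= k * (g - 2)]. *)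
have [lt_tk le_gk]: t < k /\ g * k <= 2 * (k - t) * (g - 1).
  case: (boolP (odd g)) => [/hk_odd | odd_g].
    by move=> le_k; split; nia.
  have g4 : 4 <= g by move: hg odd_g; rewrite leq_eqVlt => /orP[/eqP<-|].
  by move: (hk_even odd_g) => le_k; split; nia.
(* There are [d.+2 = 2 * (k - t) + 1] hubs, an odd number, so at most [k - t] disjoint pairs of
   them. *)
pose d := (2 * (k - t)).-1; pose m := g.-1./2.-1.
have Dd: d.+1 = 2 * (k - t) by rewrite /d; lia.
have Dg: m.+2.*2 - odd g = g by rewrite /m; lia.
exists (hub_graph d m (odd g)); split=> [||cs /hub_disjoint_dicycles]; last by lia.
  by rewrite -[X in has_girth _ X]Dg; apply: hub_girth.
rewrite Num.Theory.ceil_le_int.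
have g1: (0 < g%:R - 1 :> rat)%R.
  by rewrite Num.Theory.subr_gt0 Num.Theory.ltr1n; lia.
rewrite GRing.mulrAC Num.Theory.ler_pdivrMr // -GRing.natrM.
rewrite -[1%R]/(1%:R)%R -GRing.natrB ?(ltnW (ltnW hg)) // -pmulrn.
rewrite -GRing.natrM Num.Theory.ler_nat; apply: leq_trans le_gk _.
by rewrite leq_mul2r -Dd leq_min_outdeg_hub_graph orbT.
Qed.
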